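(* (i) For $n\ge1$ and $m\ge0$ there are bijections $$\mathcal T_{\infty,2}(n,m)\leftrightarrow\mathcal{PT}(n,m)\sqcup\mathcal{PT}(n,m+1)\leftrightarrow\mathcal{SP}(n,m),\qquad \mathcal T_{2,2}(n,m)\leftrightarrow\mathcal{RP}(n,m).$$ (ii) For $n\ge1$ there are bijections $$\mathcal T^+_{\infty,2}(n,* )\leftrightarrow\mathcal T^0_{\infty,2}(n,* )\leftrightarrow\mathcal{PT}(n)\leftrightarrow\mathcal{SP}^+(n)\leftrightarrow\mathcal{SP}^0(n),$$ $$\mathcal T_{\infty,2}(n,* )\leftrightarrow\mathcal{PT}(n)\times\{0,+\}\leftrightarrow\mathcal{SP}(n).$$ In particular, $\#\mathcal{SP}^+(n)=\#\mathcal{SP}^0(n)$ is the small Schr\''oder number $\#\mathcal{PT}(n)$. (iii) For $n\ge1$ there are bijections $$\mathcal T^+_{2,2}(n,* )\leftrightarrow\mathcal T^0_{2,2}(n,* )\leftrightarrow\mathcal{MP}_{hu}(n),\qquad \mathcal T_{2,2}(n,* )\leftrightarrow\mathcal{MP}_{hu}(n)\times\{0,+\}.$$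
   Context: \textbf{Decorated trees.} In a rooted planar tree, a node is a leaf if it has no children and internal otherwise; an angle is the sector between two consecutive children of an internal node. $\mathcal T_{\infty,2}$ is the set of finite rooted planar trees with at least one internal node, with each angle labeled by a positive integer and each internal node labeled by $0$ or $1$, such that: every internal node has at least two children; among the children of each node only the leftmost and rightmost can be leaves; only the root may have label $0$ (all other internal nodes have label $1$). $\mathcal T_{2,2}\subseteq\mathcal T_{\infty,2}$ is the subset of trees all of whose angle labels are $1$. $\deg_{\mathrm{node}}(t)$ is the sum of the internal node labels of $t$ and $\deg_{\mathrm{angle}}(t)$ the sum of its angle labels. For $i\in\{2,\infty\}$, $\mathcal T_{i,2}(n,m)$ is the set of $t\in\mathcal T_{i,2}$ with $\deg_{\mathrm{angle}}(t)=n$, $\deg_{\mathrm{node}}(t)=m$, and $\mathcal T_{i,2}(n,* )=\bigsqcup_{m\ge0}\mathcal T_{i,2}(n,m)$; superscripts $+$ and $0$ denote the subsets of trees with root label $1$ and $0$ respectively. \textbf{Planar trees.} $\mathcal{PT}(n,m)$ is the set of (undecorated) rooted planar trees, all of whose internal nodes have at least two children, with $n+1$ leaves and $m$ internal nodes; $\mathcal{PT}(n)=\bigsqcup_{m\ge0}\mathcal{PT}(n,m)$. The cardinality of $\mathcal{PT}(n)$ is the small Schr\''oder number. \textbf{Paths.} $\mathcal{SP}(n)$ is the set of Schr\''oder paths: lattice paths from $(0,0)$ to $(n,n)$ with steps $H=(1,0)$, $V=(0,1)$, $D=(1,1)$, never rising above the diagonal $y=x$. $\mathcal{SP}(n,m)$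 is the subset of those with exactly $n-m$ diagonal steps. $\mathcal{RP}(n,m)$ is the subset of paths in $\mathcal{SP}(n,m)$ in which each diagonal step is followed by a horizontal step, except if it is the last step. $\mathcal{SP}^+(n)$ is the set of paths in $\mathcal{SP}(n)$ having no diagonal step lying on the diagonal $y=x$, and $\mathcal{SP}^0(n)$ is its complement in $\mathcal{SP}(n)$. A Motzkin path of length $\ell$ is a lattice path from $(0,0)$ to $(\ell,0)$ with steps $U=(1,1)$, $H=(1,0)$, $D=(1,-1)$, never going below the $x$-axis. $\mathcal{MP}_{hu}(n)$ is the set of $(h,u)$-colored Motzkin paths from $(0,0)$ to $(n-1,0)$: Motzkin paths of length $n-1$ each of whose horizontal steps and each of whose up steps is colored with one of two colors. *)

(* Defs.v *)
From mathcomp Require Import all_boot all_order all_algebra.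

Set Implicit Arguments.
Unset Strict Implicit.
Unset Printing Implicit Defensive.

Definition in_bijection (A B : Type) : Prop := exists f : A -> B, bijective f.

Definition has_card (A : Type) (k : nat) : Prop := in_bijection A 'I_k.

Definition inner (T : Type) (s : seq T) : seq T :=
  if s is x :: s' then behead (belast x s') else [::].

(* [DNode b c0 [:: (a1, c1); ...; (ak, ck)]] is an internal node with label b
   and children c0, ..., ck from left to right; ai is the label of the angle
   between c(i-1) and ci. *)
Inductive dtree : Type :=
| DLeaf
| DNode of bool & dtree & seq (nat * dtree).

Definition children (t : dtree) : seq dtree :=
  if t is DNode _ c0 s then c0 :: unzip2 s else [::].

Definition angles (t : dtree) : seq nat :=
  if t is DNode _ _ s then unzip1 s else [::].

Definition node_label (t : dtree) : nat :=
  if t is DNode b _ _ then nat_of_bool b else 0.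

Definition is_leaf (t : dtree) : bool := nilp (children t).

(* One entry per node of t, the root coming first; hence [behead (subtrees t)]
   ranges over the nodes other than the root. *)
Fixpoint subtrees (t : dtree) : seq dtree :=
  t :: (if t is DNode _ c0 s
        then subtrees c0 ++ flatten [seq subtrees p.2 | p <- s] else [::]).

Definition deg_node (t : dtree) : nat :=
  sumn [seq node_label u | u <- subtrees t].

Definition deg_angle (t : dtree) : nat :=
  sumn [seq sumn (angles u) | u <- subtrees t].

Definition is_Tinf (t : dtree) : bool :=
  [&& has (fun u => ~~ is_leaf u) (subtrees t),
      all (fun u => all (fun a => 0 < a) (angles u)) (subtrees t),
      all (fun u => is_leaf u || (2 <= size (children u))) (subtrees t),
      all (fun u => all (fun c => ~~ is_leaf c) (inner (children u)))
          (subtrees t)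
    & all (fun u => is_leaf u || (node_label u == 1)) (behead (subtrees t))].

Definition is_T2 (t : dtree) : bool :=
  is_Tinf t && all (fun u => all (fun a => a == 1) (angles u)) (subtrees t).

Definition Tinf (n m : nat) : Type :=
  {t : dtree | [&& is_Tinf t, deg_angle t == n & deg_node t == m]}.
Definition Tinf_all (n : nat) : Type :=
  {t : dtree | is_Tinf t && (deg_angle t == n)}.
Definition Tinf_plus (n : nat) : Type :=
  {t : dtree | [&& is_Tinf t, deg_angle t == n & node_label t == 1]}.
Definition Tinf_zero (n : nat) : Type :=
  {t : dtree | [&& is_Tinf t, deg_angle t == n & node_label t == 0]}.

Definition T2 (n m : nat) : Type :=
  {t : dtree | [&& is_T2 t, deg_angle t == n & deg_node t == m]}.
Definition T2_all (n : nat) : Type :=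
  {t : dtree | is_T2 t && (deg_angle t == n)}.
Definition T2_plus (n : nat) : Type :=
  {t : dtree | [&& is_T2 t, deg_angle t == n & node_label t == 1]}.
Definition T2_zero (n : nat) : Type :=
  {t : dtree | [&& is_T2 t, deg_angle t == n & node_label t == 0]}.

Inductive ptree : Type := PNode of seq ptree.

Definition pchildren (t : ptree) : seq ptree := let: PNode s := t in s.

Definition is_pleaf (t : ptree) : bool := nilp (pchildren t).

Fixpoint psubtrees (t : ptree) : seq ptree :=
  let: PNode s := t in t :: flatten [seq psubtrees c | c <- s].

Definition nleaves (t : ptree) : nat := count is_pleaf (psubtrees t).

Definition ninternal (t : ptree) : nat :=
  count (fun u => ~~ is_pleaf u) (psubtrees t).

Definition is_PT (t : ptree) : bool :=
  all (fun u => is_pleaf u || (2 <= size (pchildren u))) (psubtrees t).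

Definition PT (n m : nat) : Type :=
  {t : ptree | [&& is_PT t, nleaves t == n.+1 & ninternal t == m]}.
Definition PT_all (n : nat) : Type :=
  {t : ptree | is_PT t && (nleaves t == n.+1)}.

(* s is the n-th small Schroeder number, indexed so that it counts the
   planar trees with n + 1 leaves. *)
Definition is_small_schroeder (n s : nat) : Prop := has_card (PT_all n) s.

Inductive step : Type := Hstep | Vstep | Dstep.

Definition step_x (a : step) : nat := if a is Vstep then 0 else 1.
Definition step_y (a : step) : nat := if a is Hstep then 0 else 1.
Definition is_H (a : step) : bool := if a is Hstep then true else false.
Definition is_D (a : step) : bool := if a is Dstep then true else false.

Definition end_x (p : seq step) : nat := sumn [seq step_x a | a <- p].
Definition end_y (p : seq step) : nat := sumn [seq step_y a | a <- p].

Definition below_diagonal (p : seq step) : bool :=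
  all (fun k => end_y (take k p) <= end_x (take k p)) (iota 0 (size p).+1).

Definition is_SP (n : nat) (p : seq step) : bool :=
  [&& end_x p == n, end_y p == n & below_diagonal p].

(* Stated additively: exactly n - m diagonal steps, so that there is no such
   path when n < m. *)
Definition has_diag_steps (n m : nat) (p : seq step) : bool :=
  count is_D p + m == n.

Definition D_followed_by_H (p : seq step) : bool :=
  sorted (fun a b => is_D a ==> is_H b) p.

(* A diagonal step lies on y = x exactly when it starts there. *)
Definition no_D_on_diagonal (p : seq step) : bool :=
  all (fun k => is_D (nth Hstep p k) ==>
                (end_x (take k p) != end_y (take k p)))
      (iota 0 (size p)).

Definition SP (n m : nat) : Type :=
  {p : seq step | is_SP n p && has_diag_steps n m p}.
Definition RP (n m : nat) : Type :=
  {p : seq step | [&& is_SP n p, has_diag_steps n m p & D_followed_by_H p]}.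
Definition SP_all (n : nat) : Type := {p : seq step | is_SP n p}.
Definition SP_plus (n : nat) : Type :=
  {p : seq step | is_SP n p && no_D_on_diagonal p}.
Definition SP_zero (n : nat) : Type :=
  {p : seq step | is_SP n p && ~~ no_D_on_diagonal p}.

(* The boolean arguments are the colors. *)
Inductive mstep : Type := MU of bool | MH of bool | MD.

Definition mstep_y (a : mstep) : int :=
  match a with MU _ => 1 | MH _ => 0 | MD => -1 end%R.

Definition height (p : seq mstep) : int := (\sum_(a <- p) mstep_y a)%R.

Definition is_Motzkin (l : nat) (p : seq mstep) : bool :=
  [&& size p == l, height p == 0%R
    & all (fun k => 0 <= height (take k p))%R (iota 0 (size p).+1)].

Definition MPhu (n : nat) : Type := {p : seq mstep | is_Motzkin n.-1 p}.

(* Main.v *)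
Require Import Defs.
From mathcomp Require Import all_boot all_order all_algebra zify.

Set Implicit Arguments.
Unset Strict Implicit.
Unset Printing Implicit Defensive.

(** All the families are put in bijection with one family of binary trees whose
nodes carry a colour.  Let S(x, u) be the generating function of planar trees
with at least two leaves, x marking leaves minus one and u internal nodes.  It
satisfies

  S = x u (1 + S)^2 + x (1 + S) S,

which describes binary trees with two kinds of nodes: a node coloured [true]
has weight x u and arbitrary subtrees, a node coloured [false] has weight x and
a nonempty right subtree.  So [bsize] counts nodes, [bweight] counts [true]
nodes, and [wf] is the condition on the [false] nodes.

- Planar trees: a [true] node is a binary vertex, a [false] node adds a new
  leftmost child to the vertex encoded by its right subtree ([planarP],
  [planar_onto]).
- Decorated trees with root label 1: a [true] node is a vertex with two
  children and angle 1; a [false] node either increases the first angle (empty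
  left subtree) or inserts its left subtree as a second child, which is then an
  inner child and not a leaf ([decoratedP], [decorated_onto]).
- Schroder paths without diagonal step on the diagonal: a nonempty such path is
  H e V f, with e any Schroder path and f again of this kind.  Cutting e at its
  last diagonal step on the diagonal, if there is one, gives either a [true]
  node, or e = r D g and a [false] node made of g and of the shorter path
  H r V f ([path_plusP], [cutK], [cut_path_plus]).

Decorated trees and Schroder paths both come in two sheets.  Changing the root
label from 1 to 0, respectively replacing H e V f by e D f, is a bijection that
lowers the weight by one; this gives PT(n,m) + PT(n,m+1) in each degree
([two_sheets], [two_sheets_weight]).

All angle labels are 1 exactly when every [false] node has also a nonempty left
subtree.  In the path encoding this left subtree is the path g that follows the
diagonal step, and g starts with H exactly when it is nonempty; hence the same
condition, [full], describes the paths in which a diagonal step is followed by a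
horizontal one or is the last step.  This is why trees with unit angles
correspond to RP(n,m) by restriction ([two_sheets_restrict]).  Nonempty [full]
trees are Motzkin paths: two empty subtrees, one of two sides, or two nonempty
subtrees of one of two colours give the empty path, the two coloured horizontal
steps and the two coloured up steps ([motzkinK], [unmotzkinK]). *)

(** * Bijections *)

Lemma bij_sym (A B : Type) : in_bijection A B -> in_bijection B A.
Proof. by case=> f [g fK gK]; exists g; exists f. Qed.

Lemma bij_trans (B A C : Type) :
  in_bijection A B -> in_bijection B C -> in_bijection A C.
Proof. by case=> f fB [g gB]; exists (g \o f); apply: bij_comp. Qed.

Lemma bij_sum (A B C D : Type) :
  in_bijection A C -> in_bijection B D ->
  in_bijection (A + B)%type (C + D)%type.
Proof.
case=> f [f' fK f'K] [g [g' gK g'K]].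
exists (fun u => match u with inl a => inl (f a) | inr b => inr (g b) end).
by exists (fun u => match u with inl a => inl (f' a) | inr b => inr (g' b) end);
  case=> x; congr (_ _).
Qed.

Lemma bij_prod_bool (A C : Type) :
  in_bijection A C -> in_bijection (A * bool)%type (C * bool)%type.
Proof.
case=> f [f' fK f'K]; exists (fun u => (f u.1, u.2)).
by exists (fun u => (f' u.1, u.2)); case=> x b /=; rewrite ?fK ?f'K.
Qed.

(** Surjectivity of [f] in place of the usual conditions on [g]: that [g] maps
[Q] into [P] and is a right inverse of [f] then follows, so that the decoding maps
below need only be computed on encoded objects. *)
Lemma bij_sig (A B : Type) (P : pred A) (Q : pred B) (f : A -> B) (g : B -> A) :
  (forall a, P a -> Q (f a) /\ g (f a) = a) ->
  (forall b, Q b -> exists2 a, P a & f a = b) ->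
  in_bijection {a | P a} {b | Q b}.
Proof.
move=> fP gP.
have gQ b : Q b -> P (g b) /\ f (g b) = b.
  by move=> /gP[a Pa <-]; have [_ ->] := fP a Pa.
exists (fun u => exist _ (f (sval u)) (fP _ (svalP u)).1 : {b | Q b}).
exists (fun v => exist _ (g (sval v)) (gQ _ (svalP v)).1 : {a | P a}).
- by move=> u; apply: val_inj; apply: (fP _ (svalP u)).2.
- by move=> v; apply: val_inj; apply: (gQ _ (svalP v)).2.
Qed.

Lemma bij_sig_eq (A : Type) (P Q : pred A) :
  P =1 Q -> in_bijection {a | P a} {a | Q a}.
Proof.
move=> ePQ; apply: (bij_sig (f := id) (g := id)) => a; first by rewrite ePQ.
by rewrite -ePQ; exists a.
Qed.

Lemma bij_sig_bool (A : Type) (P : bool -> pred A) :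
  in_bijection {u : bool * A | P u.1 u.2}
               ({a | P true a} + {a | P false a})%type.
Proof.
exists (fun u : {u : bool * A | P u.1 u.2} =>
  match u with
  | exist (true, a) h => inl (exist _ a h)
  | exist (false, a) h => inr (exist _ a h)
  end).
exists (fun v : {a | P true a} + {a | P false a} =>
  match v with
  | inl (exist a h) => exist _ (true, a) h
  | inr (exist a h) => exist _ (false, a) h
  end : {u : bool * A | P u.1 u.2}).
- by case=> [[[] a]] h.
- by case=> -[a h].
Qed.

Lemma bij_sum_bool (A : Type) : in_bijection (A + A)%type (A * bool)%type.
Proof.
exists (fun u => match u with inl a => (a, true) | inr a => (a, false) end).
by exists (fun u => if u.2 then inl u.1 else inr u.1); case=> [] // a [].
Qed.

(** Words of length at most k over a finite alphabet embed into the finite type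
of bounded sequences; the coding spares a finite type structure on [T]. *)
Lemma has_card_bounded_words (T : Type) (F : finType) (code : T -> F)
    (P : pred (seq T)) (decode : F -> T) k :
  cancel code decode ->
  (forall p, P p -> size p <= k) -> exists s, has_card {p : seq T | P p} s.
Proof.
move=> codeK Pk.
(* The second conjunct discards words with letters outside the image of code. *)
pose Q (w : k.-bseq F) := P (map decode w) && (map code (map decode w) == w).
exists #|{: {w | Q w}}|; apply: (bij_trans (B := {w | Q w})); last first.
  by exists enum_rank; exists enum_val; [apply: enum_rankK | apply: enum_valK].
apply: bij_sym.
apply: (bij_sig (f := fun w : k.-bseq F => map decode w)
                (g := fun p => insub_bseq k (map code p))) => [w|p Pp].
  case/andP=> Pw /eqP Ew; split=> //; rewrite Ew; apply: val_inj.
  by rewrite /insub_bseq insubdK // unfold_in size_bseq.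
have kp : size (map code p) <= k by rewrite size_map Pk.
have Ep : map decode (map code p) = p by rewrite mapK.
by exists (Bseq kp); rewrite /Q //= Ep Pp eqxx.
Qed.

(** * Two-coloured binary trees *)

Inductive btree : Type := Leaf | Node of bool & btree & btree.

Definition is_node x := if x is Node _ _ _ then true else false.

Fixpoint wf x :=
  if x is Node c l r then [&& c || is_node r, wf l & wf r] else true.

Fixpoint bsize x := if x is Node _ l r then (bsize l + bsize r).+1 else 0.

Fixpoint bweight x := if x is Node c l r then c + bweight l + bweight r else 0.

Fixpoint full x :=
  if x is Node c l r then [&& c || is_node l, full l & full r] else true.

Definition sized n x := wf x && (bsize x == n).

Lemma sized_is_node n x : 0 < n -> sized n x -> is_node x.
Proof. by case: x => // n0 /andP[_ /eqP En]; rewrite -En in n0. Qed.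

(** The objects satisfying [V] form two copies of the trees satisfying [C], told
apart by [lab]; the weight is that of the tree on the sheet [true] and one less
on the sheet [false]. *)
Definition two_sheets (A : Type) (C : pred btree) (V lab : pred A)
    (weight : A -> nat) (f : bool -> btree -> A) (g : A -> btree) :=
  (forall b x, C x -> [/\ V (f b x), lab (f b x) = b, g (f b x) = x
                        & weight (f b x) + ~~ b = bweight x])
  /\ (forall a, V a -> exists2 x, C x & f (lab a) x = a).

Section TwoSheets.

Variables (A : Type) (C : pred btree) (V lab : pred A) (weight : A -> nat).
Variables (f : bool -> btree -> A) (g : A -> btree).
Hypothesis fg : two_sheets C V lab weight f g.

Lemma two_sheets_restrict (Q : pred A) (D : pred btree) :
  (forall b x, C x -> Q (f b x) = D x) ->
  two_sheets (predI C D) (predI V Q) lab weight f g.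
Proof.
have [fP fS] := fg; move=> QD; split=> [b x /andP[Cx Dx]|a /andP[Va Qa]].
  by have [? ? ? ?] := fP b x Cx; split=> //=; rewrite QD // Dx andbT.
have [x Cx Ea] := fS a Va; exists x => //=; rewrite Cx.
by rewrite -(QD (lab a)) // Ea.
Qed.

Lemma two_sheets_label b :
  in_bijection {a | V a && (lab a == b)} {x | C x}.
Proof.
have [fP fS] := fg; apply: bij_sym; apply: (bij_sig (f := f b) (g := g)).
  by move=> x /(fP b)[-> -> ->]; rewrite eqxx.
by move=> a /andP[/fS[x Cx Ea] /eqP Eb]; exists x => //; rewrite -Eb.
Qed.

Lemma two_sheets_sum (Q : pred A) (R : bool -> pred btree) :
  (forall b x, C x -> Q (f b x) = R b x) ->
  in_bijection {a | V a && Q a}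
    ({x | C x && R true x} + {x | C x && R false x})%type.
Proof.
have [fP fS] := fg; move=> QR; apply: bij_sym.
apply: bij_trans (bij_sym (bij_sig_bool (fun b x => C x && R b x))) _.
apply: (bij_sig (f := fun u : bool * btree => f u.1 u.2)
                (g := fun a => (lab a, g a))).
  by case=> b x /= /andP[Cx Rx]; have [-> -> -> _] := fP b x Cx; rewrite QR.
move=> a /andP[/fS[x Cx Ea] Qa]; exists (lab a, x) => //=.
by rewrite Cx -QR // Ea.
Qed.

Lemma two_sheets_weight m :
  in_bijection {a | V a && (weight a == m)}
    ({x | C x && (bweight x == m)} + {x | C x && (bweight x == m.+1)})%type.
Proof.
apply: (two_sheets_sum (R := fun b x => bweight x == (if b then m else m.+1))).
move=> b x Cx; have [_ _ _ <-] := fg.1 b x Cx.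
by case: b => /=; rewrite ?addn0 ?addn1.
Qed.

Lemma two_sheets_all : in_bijection {a | V a} ({x | C x} * bool)%type.
Proof.
have C1 : in_bijection {x | C x && true} {x | C x}.
  by apply: bij_sig_eq => x; rewrite andbT.
apply: bij_trans (bij_sum_bool _); apply: bij_trans (bij_sum C1 C1).
apply: bij_trans (two_sheets_sum (Q := xpredT) (R := fun=> xpredT) _) => //.
by apply: bij_sig_eq => a; rewrite andbT.
Qed.

End TwoSheets.

(** * Planar trees *)

Fixpoint planar x :=
  match x with
  | Leaf => PNode [::]
  | Node true l r => PNode [:: planar l; planar r]
  | Node false l r => PNode (planar l :: pchildren (planar r))
  end.

Fixpoint unplanar t :=
  let: PNode s := t in
  (fix unforest s :=
     if s is c :: s' then
       match s' with
       | [::] => unplanar c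
       | [:: _] => Node true (unplanar c) (unforest s')
       | _ => Node false (unplanar c) (unforest s')
       end
     else Leaf) s.

(** The induction principle generated for a type nested in sequences has no
hypothesis on the children. *)
Fixpoint ptree_nested_ind (P : ptree -> Prop)
    (IH : forall s, foldr (fun c Q => P c /\ Q) True s -> P (PNode s)) t :
    P t :=
  let: PNode s := t in
  IH s ((fix all_P s : foldr (fun c Q => P c /\ Q) True s :=
           if s is c :: s' then conj (ptree_nested_ind IH c) (all_P s')
           else I) s).

Lemma all_flatten_map (T U : Type) (a : pred U) (f : T -> seq U) s :
  all a (flatten [seq f x | x <- s]) = all (fun x => all a (f x)) s.
Proof. by elim: s => //= x s IHs; rewrite all_cat IHs. Qed.

Lemma is_PT_node s :
  is_PT (PNode s) = (nilp s || (2 <= size s)) && all is_PT s.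
Proof. by rewrite /is_PT /= all_flatten_map. Qed.

Lemma nleaves_node s : nleaves (PNode s) = nilp s + sumn (map nleaves s).
Proof. by rewrite /nleaves /= count_flatten -map_comp. Qed.

Lemma ninternal_node s :
  ninternal (PNode s) = ~~ nilp s + sumn (map ninternal s).
Proof. by rewrite /ninternal /= count_flatten -map_comp. Qed.

Lemma size_planar x : wf x -> is_node x -> 1 < size (pchildren (planar x)).
Proof.
elim: x => [|[] l _ r IHr] //= /and3P[nr _ wr] _ /=.
exact: leq_trans (IHr wr nr) (leqnSn _).
Qed.

Lemma planarP x : wf x ->
  [/\ is_PT (planar x), nleaves (planar x) = (bsize x).+1,
      ninternal (planar x) = bweight x & unplanar (planar x) = x].
Proof.
elim: x => [|c l IHl r IHr] //= /and3P[cr wl wr].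
have [Pl Ll Il Ul] := IHl wl; have [Pr Lr Ir Ur] := IHr wr.
case: c cr => /= [_|nr].
  rewrite is_PT_node nleaves_node ninternal_node /= Pl Pr Ll Lr Il Ir Ul Ur.
  by split=> //; lia.
have := size_planar wr nr; case: (planar r) Pr Lr Ir Ur => [[|c [|d s]]] //=.
rewrite !is_PT_node !nleaves_node !ninternal_node /= Pl Ll Il Ul.
by move=> -> Lr Ir ->; split=> //; lia.
Qed.

(** A vertex with more than two children is peeled from the left: what remains
after removing the first child is still a vertex with two children at least. *)
Lemma planar_onto t : is_PT t -> exists2 x, wf x & planar x = t.
Proof.
elim/ptree_nested_ind: t => s IHs; rewrite is_PT_node => /andP[].
case: s IHs => [|c s] [] /=; first by exists Leaf.
move=> IHc IHs s0 /andP[/IHc[l wl El] Ps].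
elim: s c l wl El IHs {IHc} s0 Ps => // d s IHs c l wl El /= [IHd IHss] _.
case/andP=> /IHd[r wr Er] Ps; case: s IHs IHss Ps => [|e s] IHs IHss Ps.
  by exists (Node true l r); rewrite /= ?wl // El Er.
have [y wy Ey] := IHs d r wr Er IHss isT Ps.
exists (Node false l y); last by rewrite /= El Ey.
by rewrite /= wl wy andbT andbT; case: y Ey {wy}.
Qed.

Lemma bij_PT_graded n (Q : pred ptree) (R : pred btree) :
  (forall x, wf x -> Q (planar x) = R x) ->
  in_bijection {t | [&& is_PT t, nleaves t == n.+1 & Q t]}
               {x | sized n x && R x}.
Proof.
move=> QR; apply: bij_sym.
apply: (bij_sig (f := planar) (g := unplanar)) => [x|t].
  case/andP=> /andP[wx /eqP Ex]; rewrite -(QR _ wx) => ->.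
  by have [-> -> _ ->] := planarP wx; rewrite Ex eqxx.
case/and3P=> /planar_onto[x wx <-]; rewrite QR // => /eqP Ex Rx.
exists x => //; have [_ Lx _ _] := planarP wx.
by rewrite /sized wx Rx andbT /=; apply/eqP; lia.
Qed.

Lemma bij_PT n m : in_bijection (PT n m) {x | sized n x && (bweight x == m)}.
Proof.
by apply: bij_PT_graded (fun t => ninternal t == m) _ _ => x /planarP[_ _ ->].
Qed.

Lemma bij_PT_all n : in_bijection (PT_all n) {x | sized n x}.
Proof.
apply: bij_trans (bij_trans (bij_PT_graded n (Q := xpredT) (R := xpredT) _) _).
- by apply: bij_sig_eq => t; rewrite andbT.
- by [].
- by apply: bij_sig_eq => x; rewrite andbT.
Qed.

(** * Decorated trees *)

Definition relabel b t := if t is DNode _ c s then DNode b c s else t.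

Fixpoint decorated x :=
  match x with
  | Leaf => DLeaf
  | Node true l r => DNode true (decorated l) [:: (1, decorated r)]
  | Node false l r =>
    if decorated r is DNode b c ((a, d) :: s) then
      if l is Leaf then DNode b c ((a.+1, d) :: s)
      else DNode b c ((1, decorated l) :: (a, d) :: s)
    else DLeaf
  end.

(** The root label is ignored, so that one map decodes both sheets. *)
Fixpoint undecorate t :=
  if t is DNode _ c s then
    (fix merge s :=
       if s is (a, d) :: s' then
         iter a.-1 (Node false Leaf)
           (if s' is [::] then Node true (undecorate c) (undecorate d)
            else Node false (undecorate d) (merge s'))
       else Leaf) s
  else Leaf.

Fixpoint dtree_nested_ind (P : dtree -> Prop) (PL : P DLeaf)
    (IH : forall b c s, P c -> foldr (fun d Q => P d /\ Q) True (unzip2 s) ->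
          P (DNode b c s)) t : P t :=
  if t is DNode b c s then
    IH b c s (dtree_nested_ind PL IH c)
      ((fix all_P s : foldr (fun d Q => P d /\ Q) True (unzip2 s) :=
          if s is (a, d) :: s' then
            conj (dtree_nested_ind PL IH d) (all_P s')
          else I) s)
  else PL.

Definition inf_node u :=
  [&& all (fun a => 0 < a) (angles u),
      is_leaf u || (2 <= size (children u))
    & all (fun c => ~~ is_leaf c) (inner (children u))].

(** The trees that may hang below the root: leaves, or decorated trees with root
label 1. *)
Definition inf_branch t :=
  all (fun u => inf_node u && (is_leaf u || (node_label u == 1))) (subtrees t).

Lemma is_Tinf_node b c s :
  is_Tinf (DNode b c s)
  = [&& inf_node (DNode b c s), inf_branch c & all inf_branch (unzip2 s)].
Proof.
have inf_nodeE r : all inf_node r =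
    [&& all (fun u => all (fun a => 0 < a) (angles u)) r,
        all (fun u => is_leaf u || (2 <= size (children u))) r
      & all (fun u => all (fun c => ~~ is_leaf c) (inner (children u))) r].
  by rewrite -!all_predI; apply: eq_all.
transitivity (all inf_node (subtrees (DNode b c s)) &&
  all (fun u => is_leaf u || (node_label u == 1))
      (behead (subtrees (DNode b c s)))).
  by rewrite inf_nodeE /is_Tinf -!andbA.
rewrite [subtrees _]/= [behead _]/= [all inf_node _]/= -andbA -all_predI.
by rewrite all_cat all_flatten_map all_map.
Qed.

Lemma inf_branch_node b c s :
  inf_branch (DNode b c s) = b && is_Tinf (DNode b c s).
Proof.
rewrite is_Tinf_node /inf_branch /= all_cat all_flatten_map all_map.
by case: b; rewrite /= ?andbT ?andbF.
Qed.

Lemma is_Tinf_binary b c a d :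
  is_Tinf (DNode b c [:: (a, d)]) = [&& 0 < a, inf_branch c & inf_branch d].
Proof. by rewrite is_Tinf_node /inf_node /= !andbT. Qed.

Lemma is_Tinf_first_angle b c a d s :
  is_Tinf (DNode b c ((a.+2, d) :: s)) = is_Tinf (DNode b c ((a.+1, d) :: s)).
Proof. by rewrite !is_Tinf_node. Qed.

(** Removing the second child together with its left angle; as other children
follow, that child is inner and hence not a leaf. *)
Lemma is_Tinf_first_child b c a d p s :
  is_Tinf (DNode b c ((a, d) :: p :: s))
  = [&& 0 < a, ~~ is_leaf d, inf_branch d & is_Tinf (DNode b c (p :: s))].
Proof.
rewrite !is_Tinf_node /inf_node /=.
case: p => e h /=; case: (inf_branch d); case: (is_leaf d); case: (0 < a);
  by rewrite ?andbF //= ?andbT.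
Qed.

Lemma is_Tinf_relabel b t : is_Tinf (relabel b t) = is_Tinf t.
Proof. by case: t => // b' c s; rewrite /= !is_Tinf_node. Qed.

Lemma deg_angle_node b c s :
  deg_angle (DNode b c s)
  = sumn (unzip1 s) + deg_angle c + sumn (map deg_angle (unzip2 s)).
Proof.
rewrite /deg_angle /= map_cat sumn_cat map_flatten sumn_flatten -!map_comp.
by rewrite addnA.
Qed.

Lemma deg_node_node b c s :
  deg_node (DNode b c s)
  = b + deg_node c + sumn (map deg_node (unzip2 s)).
Proof.
rewrite /deg_node /= map_cat sumn_cat map_flatten sumn_flatten -!map_comp.
by rewrite addnA.
Qed.

Definition unit_angles t :=
  all (fun u => all (fun a => a == 1) (angles u)) (subtrees t).

Lemma unit_angles_node b c s :
  unit_angles (DNode b c s)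
  = [&& all (fun a => a == 1) (unzip1 s), unit_angles c
      & all unit_angles (unzip2 s)].
Proof. by rewrite /unit_angles /= all_cat all_flatten_map !all_map. Qed.

(** The head constructor and the positive first angle are the invariant which
ensures that the [false] case of [decorated] finds an angle to act on. *)
Lemma decorated_node x : wf x -> is_node x ->
  exists c a d s, [/\ decorated x = DNode true c ((a.+1, d) :: s),
                      is_Tinf (decorated x) & inf_branch (decorated x)].
Proof.
elim: x => [|[] l IHl r IHr] //=.
  move=> /andP[wl wr] _; exists (decorated l), 0, (decorated r), [::].
  rewrite inf_branch_node is_Tinf_binary /=.
  have inf x : wf x -> (is_node x -> exists c a d s,
    [/\ decorated x = DNode true c ((a.+1, d) :: s),
        is_Tinf (decorated x) & inf_branch (decorated x)]) ->
    inf_branch (decorated x).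
    by case: x => // k y z wx IHx; have [c [a [d [s []]]]] := IHx isT.
  by rewrite (inf _ wl (IHl wl)) (inf _ wr (IHr wr)).
move=> /and3P[nr wl wr] _; have [c [a [d [s [Er Tr Br]]]]] := IHr wr nr.
rewrite Er in Tr *; case: l IHl wl => [|k l1 l2] IHl wl.
  exists c, a.+1, d, s.
  by rewrite inf_branch_node is_Tinf_first_angle Tr.
have [c' [a' [d' [s' [El Tl Bl]]]]] := IHl wl isT.
exists c, 0, (decorated (Node k l1 l2)), ((a.+1, d) :: s).
by rewrite inf_branch_node is_Tinf_first_child Tr Bl El.
Qed.

Lemma undecorate_relabel b t : undecorate (relabel b t) = undecorate t.
Proof. by case: t. Qed.

Lemma decoratedP x : wf x ->
  [/\ deg_angle (decorated x) = bsize x, deg_node (decorated x) = bweight x,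
      unit_angles (decorated x) = full x & undecorate (decorated x) = x].
Proof.
elim: x => [|c l IHl r IHr] //= /and3P[cr wl wr].
have [Al Ml Fl Ul] := IHl wl; have [Ar Mr Fr Ur] := IHr wr.
case: c cr => /= [_|nr].
  rewrite deg_angle_node deg_node_node unit_angles_node /= Al Ar Ml Mr Fl Fr.
  by rewrite Ul Ur andbT; split=> //; lia.
have [c [a [d [s [Er _ _]]]]] := decorated_node wr nr.
move: Ar Mr Fr Ur; rewrite Er; case: l Al Ml Fl Ul {IHl wl} => [|k l1 l2].
  rewrite !deg_angle_node !deg_node_node !unit_angles_node /=.
  by move=> _ _ _ _ <- <- _ <-; split.
move: (decorated _) => t <- <- <- Ul.
rewrite !deg_angle_node !deg_node_node !unit_angles_node /=.
move=> <- <- <- Ur; rewrite Ul; split; [lia | lia | | by congr (Node _ _ _)].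
by rewrite [unit_angles c && _]andbCA andbCA.
Qed.

Lemma decorated_onto t : inf_branch t -> exists2 x, wf x & decorated x = t.
Proof.
elim/dtree_nested_ind: t => [_|b c s IHc IHs]; first by exists Leaf.
rewrite inf_branch_node => /andP[-> Ts].
suff [x wx [nx Ex]] :
    exists2 x, wf x & is_node x /\ decorated x = DNode true c s.
  by exists x.
elim: s IHs Ts => [_|[a d] s IHs /= [IHd IHss]]; first by rewrite is_Tinf_node.
case: a => [|a]; first by rewrite is_Tinf_node.
(* A first angle greater than 1 comes from a false node with empty left
   subtree. *)
elim: a => [|a IHa] Ts; last first.
  rewrite is_Tinf_first_angle in Ts; have [x wx [nx Ex]] := IHa Ts.
  by exists (Node false Leaf x); rewrite /= ?nx // Ex.
case: s IHs IHss Ts => [|p s] IHs IHss.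
  rewrite is_Tinf_binary => /and3P[_ /IHc[l wl <-] /IHd[r wr <-]].
  by exists (Node true l r); rewrite //= wl.
rewrite is_Tinf_first_child => /and4P[_ Ld /IHd[l wl El] Ts].
have [x wx [nx Ex]] := IHs IHss Ts.
exists (Node false l x); rewrite /= ?nx ?wl //; split=> //.
rewrite Ex; case: p {IHs IHss Ts Ex}.
by case: l El {wl} Ld => [<- //|k l1 l2 <-].
Qed.

Lemma two_sheets_Tinf n : 0 < n ->
  two_sheets (sized n) (fun t => is_Tinf t && (deg_angle t == n))
    (fun t => node_label t == 1) deg_node
    (fun b x => relabel b (decorated x)) undecorate.
Proof.
move=> n0; split=> [b x Cx|t /andP[Tt /eqP At]].
  have nx := sized_is_node n0 Cx; case/andP: Cx => wx /eqP En.
  have [Ax Mx _ Ux] := decoratedP wx.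
  have [c [a [d [s [Ex Tx _]]]]] := decorated_node wx nx.
  rewrite is_Tinf_relabel undecorate_relabel Tx Ux -Mx.
  move: Ax; rewrite Ex !deg_angle_node /= !deg_node_node => ->.
  by split=> //; [rewrite En eqxx | case: b | case: b => /=; lia].
case: t Tt At => // b c s Tt At.
have Bt : inf_branch (DNode true c s).
  by rewrite inf_branch_node -(is_Tinf_relabel true) in Tt *.
have [x wx Ex] := decorated_onto Bt; exists x; last by rewrite Ex; case: (b).
have [Ax _ _ _] := decoratedP wx.
by rewrite /sized wx -Ax Ex -At !deg_angle_node /=.
Qed.

Lemma unit_angles_decorated b x : wf x ->
  unit_angles (relabel b (decorated x)) = full x.
Proof.
move=> /decoratedP[_ _ <- _].
by case: (decorated x) => // b' c s; rewrite /= !unit_angles_node.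
Qed.

(** * Words of Dyck type *)

Inductive letter (A B : Type) : Type := Up of A | Flat of B | Down.
Arguments Up {A B}.
Arguments Flat {A B}.
Arguments Down {A B}.

(** The first-return decomposition of words with up, flat and down letters that
stay above their starting height and come back to it: [Arch a t u] is an up
letter, the word of [t], the matching down letter, the word of [u].  Schroder
paths have one colour of letters and Motzkin paths two. *)
Inductive motz (A B : Type) : Type :=
| Nil
| Lev of B & motz A B
| Arch of A & motz A B & motz A B.
Arguments Nil {A B}.
Arguments Lev {A B}.
Arguments Arch {A B}.

Section Words.

Variables A B : Type.
Implicit Types (t : motz A B) (p q : seq (letter A B)).

Fixpoint word t :=
  match t with
  | Nil => [::]
  | Lev b t1 => Flat b :: word t1
  | Arch a t1 t2 => Up a :: word t1 ++ Down :: word t2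
  end.

Fixpoint descends h p :=
  match p with
  | [::] => h == 0
  | Up _ :: q => descends h.+1 q
  | Flat _ :: q => descends h q
  | Down :: q => if h is h'.+1 then descends h' q else false
  end.

(** Reading from the right, a suffix that goes down by h levels is a sequence of
h + 1 words separated by down letters; an up letter closes the first two of
them into an arch. *)
Fixpoint parse p : motz A B * seq (motz A B) :=
  match p with
  | [::] => (Nil, [::])
  | Flat b :: q => let: (t, s) := parse q in (Lev b t, s)
  | Up a :: q => let: (t, s) := parse q in (Arch a t (head Nil s), behead s)
  | Down :: q => let: (t, s) := parse q in (Nil, t :: s)
  end.

Lemma descends_word h t q : descends h (word t ++ q) = descends h q.
Proof.
elim: t h q => //= a t1 IH1 t2 IH2 h q.
by rewrite -catA IH1 /= IH2.
Qed.

Lemma parse_word t q s : parse q = (Nil, s) -> parse (word t ++ q) = (t, s).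
Proof.
elim: t q s => //= [b t IHt|a t1 IH1 t2 IH2] q s Eq; first by rewrite (IHt q s).
by rewrite -catA /= (IH1 _ (t2 :: s)) //= (IH2 q s).
Qed.

Lemma wordK t : (parse (word t)).1 = t.
Proof. by rewrite -[word t]cats0 (@parse_word t [::] [::]). Qed.

Lemma word_onto p : descends 0 p -> exists t, word t = p.
Proof.
suff: forall h, descends h p -> exists t s,
    size s = h /\ p = word t ++ flatten [seq Down :: word u | u <- s].
  by move=> H /(H 0)[t [[|u s] [//= _ ->]]]; exists t; rewrite cats0.
elim: p => [h /eqP->|[a|b|] p IHp h] /=; first by exists Nil, [::].
- move=> /IHp[t [[|u s] [//= [Es] ->]]]; exists (Arch a t u), s.
  by rewrite /= -catA.
- by move=> /IHp[t [s [Es ->]]]; exists (Lev b t), s.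
- case: h => // h /IHp[t [s [Es ->]]]; exists Nil, (t :: s).
  by rewrite /= Es.
Qed.

Fixpoint arches t :=
  match t with
  | Nil => 0 | Lev _ u => arches u | Arch _ u v => (arches u + arches v).+1
  end.

Fixpoint levels t :=
  match t with
  | Nil => 0 | Lev _ u => (levels u).+1 | Arch _ u v => levels u + levels v
  end.

End Words.

(** Splitting off the empty prefix turns a condition on all prefixes of a word
into a recursion along the word. *)
Lemma all_iotaS (P : pred nat) n :
  all P (iota 0 n.+1) = P 0 && all (fun k => P k.+1) (iota 0 n).
Proof. by rewrite /= (iotaDl 1 0) all_map. Qed.

(** * Schroder paths *)

Notation spath := (motz unit unit).

Definition letter_of_step (a : step) : letter unit unit :=
  match a with Hstep => Up tt | Vstep => Down | Dstep => Flat tt end.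

Definition step_of_letter (a : letter unit unit) : step :=
  match a with Up _ => Hstep | Down => Vstep | Flat _ => Dstep end.

Lemma step_of_letterK : cancel step_of_letter letter_of_step.
Proof. by case=> [[]|[]|]. Qed.

Lemma letter_of_stepK : cancel letter_of_step step_of_letter.
Proof. by case. Qed.

Fixpoint steps (t : spath) : seq step :=
  match t with
  | Nil => [::]
  | Lev _ t1 => Dstep :: steps t1
  | Arch _ t1 t2 => Hstep :: steps t1 ++ Vstep :: steps t2
  end.

Lemma stepsE t : steps t = map step_of_letter (word t).
Proof.
by elim: t => //= [_ t ->|_ t1 -> t2 ->] //; rewrite map_cat.
Qed.

(** The offset h is the excess of x over y at the start of the suffix p. *)
Lemma below_diagonal_descends h p :
  all (fun k => end_y (take k p) <= h + end_x (take k p)) (iota 0 (size p).+1)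
    && (end_y p == h + end_x p)
  = descends h (map letter_of_step p).
Proof.
elim: p h => [|a p IHp] h; first by rewrite /= addn0 eq_sym.
change (size (a :: p)) with (size p).+1.
rewrite all_iotaS take0 [end_y [::]]/= leq0n andTb.
have L0 : 0 \in iota 0 (size p).+1 by [].
move: (iota _ _) IHp L0 => L IHp L0; case: a => /=.
- rewrite -IHp; congr (_ && _); last by rewrite /end_x /end_y /=; lia.
  by apply: eq_all => k; rewrite /end_x /end_y /=; lia.
- case: h => [|h].
    (* A vertical step at height 0 leaves the region at the first prefix. *)
    apply/negbTE/negP => /andP[/allP P _].
    by have := P 0 L0; rewrite /= take0.
  by rewrite -IHp.
- rewrite -IHp; congr (_ && _); last by rewrite /end_x /end_y /=; lia.
  by apply: eq_all => k; rewrite /end_x /end_y /=; lia.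
Qed.

Lemma is_SP_descends n p :
  is_SP n p = descends 0 (map letter_of_step p) && (end_x p == n).
Proof.
rewrite -below_diagonal_descends /is_SP /below_diagonal.
rewrite (eq_all (a2 := fun k => end_y (take k p) <= 0 + end_x (take k p))) //.
by case: (all _ _) => /=; rewrite ?andbF //; lia.
Qed.

Lemma end_x_steps t : end_x (steps t) = arches t + levels t.
Proof.
rewrite /end_x; elim: t => //= [_ t ->|_ t1 IH1 t2 IH2]; first by lia.
by rewrite map_cat sumn_cat /= IH1 IH2; lia.
Qed.

Lemma count_D_steps t : count is_D (steps t) = levels t.
Proof.
by elim: t => //= [_ t -> //|_ t1 IH1 t2 IH2]; rewrite count_cat /= IH1 IH2.
Qed.

Lemma count_H_steps t : count is_H (steps t) = arches t.
Proof.
by elim: t => //= _ t1 IH1 t2 IH2; rewrite count_cat /= IH1 IH2.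
Qed.

(** A level step at the outermost nesting depth, that is, a diagonal step on the
diagonal. *)
Fixpoint grounded_level (t : spath) :=
  match t with
  | Nil => false | Lev _ _ => true | Arch _ _ t2 => grounded_level t2
  end.

Lemma no_D_on_diagonal_steps t :
  no_D_on_diagonal (steps t) = ~~ grounded_level t.
Proof.
(* The condition for a suffix that starts with excess h of x over y. *)
pose low h p := all (fun k => is_D (nth Hstep p k) ==>
  (h + end_x (take k p) != end_y (take k p))) (iota 0 (size p)).
have lowS h a p : low h (a :: p) = (is_D a ==> (h != 0)) &&
    all (fun k => is_D (nth Hstep p k) ==>
      (h + (step_x a + end_x (take k p)) != step_y a + end_y (take k p)))
      (iota 0 (size p)).
  rewrite /low; change (size (a :: p)) with (size p).+1.
  by rewrite all_iotaS take0 [end_x [::]]/= addn0.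
have lowH h p : low h (Hstep :: p) = low h.+1 p.
  by rewrite lowS /=; apply: eq_all => k; rewrite /= addnA addn1 add0n.
have lowV h p : low h.+1 (Vstep :: p) = low h p.
  by rewrite lowS /=; apply: eq_all => k; rewrite /= add0n add1n addSn eqSS.
have lowD h p : low h (Dstep :: p) = (h != 0) && low h p.
  rewrite lowS /=; congr andb; apply: eq_all => k.
  by rewrite /= addnCA eqn_add2l.
have high u h q : low h.+1 (steps u ++ q) = low h.+1 q.
  elim: u h q => //= [_ u IHu|_ u1 IH1 u2 IH2] h q; first by rewrite lowD IHu.
  by rewrite lowH -catA IH1 /= lowV IH2.
rewrite -[LHS]/(low 0 (steps t)); elim: t => //= _ t1 _ t2 IH2.
by rewrite lowH high lowV.
Qed.

(** [terminal] tells whether a level may end the word.  It may at the end of the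
whole path only: inside an arch, the next step is vertical. *)
Fixpoint arch_after_level terminal (t : spath) :=
  match t with
  | Nil => true
  | Lev _ u =>
    match u with Nil => terminal | Lev _ _ => false | Arch _ _ _ => true end
    && arch_after_level terminal u
  | Arch _ u v => arch_after_level false u && arch_after_level terminal v
  end.

Lemma D_followed_by_H_steps t :
  D_followed_by_H (steps t) = arch_after_level true t.
Proof.
pose follow := sorted (fun a b => is_D a ==> is_H b).
have followS a p : follow (a :: p) =
    (if p is b :: _ then is_D a ==> is_H b else true) && follow p.
  by case: p.
have inside u q :
    follow (steps u ++ Vstep :: q) = arch_after_level false u && follow q.
  elim: u q => [|[] u IHu|[] u1 IH1 u2 IH2] q; rewrite [steps _]/= ?cat_cons.
  - by rewrite followS; case: q.
  - by rewrite followS IHu andbA; case: u {IHu}.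
  - rewrite followS -catA IH1 IH2 /= -andbA.
    by case: (steps u1).
rewrite -[LHS]/(follow (steps t)).
elim: t => [|[] t IHt|[] t1 IH1 t2 IH2] //; rewrite [steps _]/= followS.
- by rewrite IHt; case: t {IHt}.
- by rewrite inside IH2; case: (steps t1).
Qed.

(** * Schroder paths and two-coloured trees *)

Fixpoint mcat (t u : spath) : spath :=
  match t with
  | Nil => u
  | Lev b t1 => Lev b (mcat t1 u)
  | Arch a t1 t2 => Arch a t1 (mcat t2 u)
  end.

(** t D u. *)
Definition graft (t u : spath) := mcat t (Lev tt u).

(** In the [false] case, the path H e V u of the right subtree becomes
H e D g V u, where g is the path of the left subtree.  Since g has no diagonal
step on the diagonal, this D is the last one inside the first arch at its base
level, which makes the step reversible. *)
Fixpoint path_plus x : spath :=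
  match x with
  | Leaf => Nil
  | Node true l r => Arch tt (path_plus r) (path_plus l)
  | Node false l r =>
    if path_plus r is Arch _ t u then Arch tt (graft t (path_plus l)) u else Nil
  end.

(** H u V v becomes u D v: a horizontal and a vertical step merge into the last
diagonal step on the diagonal. *)
Definition open_arch (t : spath) :=
  if t is Arch _ u v then graft u v else Nil.

Definition path_sheet b x := if b then path_plus x else open_arch (path_plus x).

(** The tree of H e V f, where d encodes the pieces of e as computed by [cut]
and y encodes f: one [false] node for each diagonal step of e on its base level. *)
Definition code_arch (d : btree * seq btree) y :=
  foldl (fun r l => Node false l r) (Node true y d.1) d.2.

(** A path cut at its diagonal steps on the diagonal, f0 D f1 D ... D fk, as the
trees of f0 and of f1, ..., fk. *)
Fixpoint cut (t : spath) : btree * seq btree :=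
  match t with
  | Nil => (Leaf, [::])
  | Lev _ u => (Leaf, (cut u).1 :: (cut u).2)
  | Arch _ u v => (code_arch (cut u) (cut v).1, (cut v).2)
  end.

Definition glue (d : btree * seq btree) : spath :=
  foldl (fun t x => graft t (path_plus x)) (path_plus d.1) d.2.

(** On the sheet [false], r D g with g the last piece is the image under
[open_arch] of H r V g. *)
Definition path_unsheet t :=
  if cut t is (x, y :: s) then code_arch (x, belast y s) (last y s)
  else (cut t).1.

Lemma cut_graft t u :
  (cut u).2 = [::] -> cut (graft t u) = ((cut t).1, rcons (cut t).2 (cut u).1).
Proof.
move=> Eu; elim: t => [|b t IHt|a t1 _ t2 IH2] /=; first by rewrite Eu.
- by rewrite [cut _]IHt.
- by rewrite [cut (mcat _ _)]IH2.
Qed.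

(** Each [false] node of the spine grafts one more piece into the first arch. *)
Lemma path_plus_code_arch d y :
  path_plus (code_arch d y) = Arch tt (glue d) (path_plus y).
Proof.
case: d => x s; elim/last_ind: s => //= s l IHs.
by rewrite /code_arch /glue /= !foldl_rcons /= [path_plus _]IHs.
Qed.

Lemma glue_arch x s u v :
  path_plus x = Arch tt u v ->
  glue (x, s) = Arch tt u (foldl (fun t x => graft t (path_plus x)) v s).
Proof.
rewrite /glue /= => ->; elim: s v => //= y s IHs v.
by rewrite -IHs.
Qed.

Lemma cutK : cancel cut glue.
Proof.
elim=> [|[] t IHt|[] t1 IH1 t2 IH2] //=.
- rewrite -[in RHS]IHt /glue /=; case: (cut t) => x s /= {IHt}.
  by elim/last_ind: s => //= s y IHs; rewrite !foldl_rcons IHs.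
- rewrite (glue_arch _ (path_plus_code_arch _ _)) IH1; congr Arch.
  by rewrite -[RHS]IH2 /glue.
Qed.

Lemma path_plus_node x :
  wf x -> is_node x -> exists t u, path_plus x = Arch tt t u.
Proof.
elim: x => //= -[] l _ r IHr; first by exists (path_plus r), (path_plus l).
move=> /and3P[nr _ wr] _; have [t [u ->]] := IHr wr nr.
by exists (graft t (path_plus l)), u.
Qed.

Lemma cut_path_plus x : wf x -> cut (path_plus x) = (x, [::]).
Proof.
elim: x => //= -[] l IHl r IHr.
  by move=> /= /andP[wl wr]; rewrite IHl // IHr.
move=> /= /and3P[nr wl wr]; have [t [u Er]] := path_plus_node wr nr.
have := IHr wr; rewrite Er /= => -[Ex Eu].
rewrite cut_graft IHl //= Eu /code_arch /= foldl_rcons.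
by congr (Node _ _ _, _).
Qed.

Lemma grounded_level_graft t u : grounded_level (graft t u).
Proof. by elim: t. Qed.

Lemma grounded_level_path_plus x : ~~ grounded_level (path_plus x).
Proof.
elim: x => //= -[] l IHl r //=.
by case: (path_plus r).
Qed.

Lemma wf_code_arch d y : wf d.1 -> all wf d.2 -> wf y ->
  wf (code_arch d y) && is_node (code_arch d y).
Proof.
case: d => x s /= wx; elim/last_ind: s => [_ wy|s l IHs].
  by rewrite /= wx wy.
rewrite all_rcons => /andP[wl ws] wy; rewrite /code_arch /= foldl_rcons /=.
by have := IHs ws wy; rewrite /code_arch /= => /andP[-> ->]; rewrite wl.
Qed.

Lemma wf_cut t : wf (cut t).1 && all wf (cut t).2.
Proof.
elim: t => //= _ t1 /andP[w1 s1] t2 /andP[w2 ->].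
by have /andP[->] := wf_code_arch w1 s1 w2.
Qed.

Lemma arches_graft t u : arches (graft t u) = arches t + arches u.
Proof. by elim: t => //= a t1 _ t2 ->; rewrite addnA. Qed.

Lemma levels_graft t u : levels (graft t u) = (levels t + levels u).+1.
Proof. by elim: t => //= [_ t ->|_ t1 _ t2 ->] //; lia. Qed.

Definition is_arch (t : spath) := if t is Arch _ _ _ then true else false.

(** The level added by the grafting is followed by the first step of u, which is
an arch unless u is empty. *)
Lemma arch_after_level_graft b t u : ~~ grounded_level u ->
  arch_after_level b (graft t u)
  = [&& arch_after_level false t, b || is_arch u & arch_after_level b u].
Proof.
move=> gu; elim: t => [|c t IHt|c t1 _ t2 IH2] /=.
- by case: u gu => [|?|? ? ?] //= _; rewrite ?orbF ?orbT ?andbT.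
- by rewrite [arch_after_level b _]IHt; case: t {IHt}.
- by rewrite [arch_after_level b (mcat _ _)]IH2 andbA.
Qed.

Lemma arch_after_level_ungrounded b t : ~~ grounded_level t ->
  arch_after_level b t = arch_after_level false t.
Proof. by elim: t => //= _ t1 _ t2 IH2 /IH2->. Qed.

Lemma is_arch_path_plus x : wf x -> is_arch (path_plus x) = is_node x.
Proof. by case: x => // c l r wx; have [t [u ->]] := path_plus_node wx isT. Qed.

Lemma path_plusP x : wf x ->
  [/\ arches (path_plus x) = bweight x,
      arches (path_plus x) + levels (path_plus x) = bsize x
    & arch_after_level false (path_plus x) = full x].
Proof.
elim: x => //= -[] l IHl r IHr.
  move=> /= /andP[/IHl[Al Ll Fl] /IHr[Ar Lr Fr]].
  by rewrite Al Ar Fl Fr -Ll -Lr andbC; split=> //; lia.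
move=> /= /and3P[nr wl wr]; have [t [u Er]] := path_plus_node wr nr.
have := IHr wr; have [Al Ll Fl] := IHl wl; rewrite Er /= => -[<- <- <-].
rewrite arches_graft levels_graft.
rewrite arch_after_level_graft ?grounded_level_path_plus //.
rewrite is_arch_path_plus // Fl -Al -Ll; split; [lia | lia |].
by case: (arch_after_level false t); case: (full l); rewrite /= ?andbF ?andbT.
Qed.

Lemma path_sheetP b x : wf x -> is_node x ->
  [/\ arches (path_sheet b x) + ~~ b = bweight x,
      arches (path_sheet b x) + levels (path_sheet b x) = bsize x,
      grounded_level (path_sheet b x) = ~~ b,
      arch_after_level true (path_sheet b x) = full x
    & path_unsheet (path_sheet b x) = x].
Proof.
move=> wx nx; have [Ax Lx Fx] := path_plusP wx; case: b => /=.
  have gx := grounded_level_path_plus x.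
  rewrite (negbTE gx) addn0 arch_after_level_ungrounded //.
  by rewrite /path_unsheet cut_path_plus.
have [t [u Ex]] := path_plus_node wx nx.
have gu : ~~ grounded_level u by have := grounded_level_path_plus x; rewrite Ex.
have := cut_path_plus wx; rewrite Ex /= => -[Ux cu2].
move: Ax Lx Fx; rewrite Ex /= => <- <- <-.
rewrite arches_graft levels_graft grounded_level_graft.
rewrite arch_after_level_graft // arch_after_level_ungrounded //.
rewrite /path_unsheet cut_graft //.
split=> //; [lia | lia |].
move: Ux; case: (cut t) => y [|z s] //=.
by rewrite belast_rcons last_rcons.
Qed.

Lemma path_sheet_onto t : t <> Nil ->
  exists2 x, wf x && is_node x & path_sheet (~~ grounded_level t) x = t.
Proof.
move=> t0; have := cutK t; have := wf_cut t.
case: (cut t) => x s; elim/last_ind: s => [|s y _] /= /andP[wx ws] Et.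
  move: Et; rewrite /glue /= => Et; exists x; last first.
    by rewrite -Et grounded_level_path_plus.
  by rewrite wx; case: x Et {wx} => //= /esym/t0.
move: ws; rewrite all_rcons => /andP[wy ws].
exists (code_arch (x, s) y); first exact: wf_code_arch.
rewrite -Et /glue /= foldl_rcons grounded_level_graft /path_sheet /=.
by rewrite path_plus_code_arch.
Qed.

Definition spath_of_steps p : spath := (parse (map letter_of_step p)).1.

Lemma stepsK : cancel steps spath_of_steps.
Proof.
move=> t; rewrite /spath_of_steps stepsE (mapK step_of_letterK).
exact: wordK.
Qed.

Lemma is_SP_steps n t : is_SP n (steps t) = (arches t + levels t == n).
Proof.
rewrite is_SP_descends stepsE (mapK step_of_letterK) -stepsE end_x_steps.
by rewrite -[word t]cats0 descends_word.
Qed.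

Lemma is_SP_onto n p : is_SP n p -> exists t, steps t = p.
Proof.
rewrite is_SP_descends => /andP[/word_onto[t Et] _]; exists t.
by rewrite stepsE Et (mapK letter_of_stepK).
Qed.

Lemma two_sheets_SP n : 0 < n ->
  two_sheets (sized n) (is_SP n) no_D_on_diagonal (count is_H)
    (fun b x => steps (path_sheet b x)) (path_unsheet \o spath_of_steps).
Proof.
move=> n0; split=> [b x Cx|p Vp].
  have nx := sized_is_node n0 Cx; case/andP: Cx => wx /eqP En.
  have [Ax Lx gx _ Ux] := path_sheetP b wx nx.
  rewrite is_SP_steps Lx no_D_on_diagonal_steps gx negbK count_H_steps.
  by rewrite /= stepsK En eqxx.
have [t Et] := is_SP_onto Vp; rewrite -Et is_SP_steps in Vp *.
have t0 : t <> Nil by move=> t0; move: Vp n0; rewrite t0 => /eqP<-.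
have [x /andP[wx nx] Ex] := path_sheet_onto t0; exists x; last first.
  by rewrite no_D_on_diagonal_steps Ex.
have [_ Lx _ _ _] := path_sheetP (~~ grounded_level t) wx nx.
by rewrite /sized wx -Lx Ex.
Qed.

Lemma D_followed_by_H_path_sheet b x : wf x -> is_node x ->
  D_followed_by_H (steps (path_sheet b x)) = full x.
Proof.
by move=> wx nx; rewrite D_followed_by_H_steps; have [] := path_sheetP b wx nx.
Qed.

(** n is the number of horizontal and diagonal steps together. *)
Lemma has_diag_steps_count_H n m p :
  is_SP n p -> has_diag_steps n m p = (count is_H p == m).
Proof.
move=> Vp; have [t Et] := is_SP_onto Vp; rewrite -Et in Vp *.
rewrite is_SP_steps in Vp; rewrite /has_diag_steps count_D_steps count_H_steps.
by rewrite -(eqP Vp) addnC eqn_add2r eq_sym.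
Qed.

Lemma size_SP n p : is_SP n p -> size p <= n + n.
Proof.
case/and3P=> /eqP Ex /eqP Ey _; rewrite -[X in X + _]Ex -[X in _ + X]Ey.
by rewrite /end_x /end_y; elim: p {Ex Ey} => //= a p IHp; case: a => /=; lia.
Qed.

Lemma has_card_SP_plus n : exists s, has_card (SP_plus n) s.
Proof.
pose code a := match a with
  | Hstep => Some true | Vstep => Some false | Dstep => None end.
pose decode o := match o with
  | Some true => Hstep | Some false => Vstep | None => Dstep end.
have codeK : cancel code decode by case.
apply: (has_card_bounded_words codeK (k := n + n)).
by move=> p /andP[/size_SP].
Qed.

(** * Motzkin paths *)

Notation mpath := (motz bool bool).

Definition letter_of_mstep (a : mstep) : letter bool bool :=
  match a with MU c => Up c | MH c => Flat c | MD => Down end.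

Definition mstep_of_letter (a : letter bool bool) : mstep :=
  match a with Up c => MU c | Flat c => MH c | Down => MD end.

Lemma letter_of_mstepK : cancel letter_of_mstep mstep_of_letter.
Proof. by case. Qed.

Lemma mstep_of_letterK : cancel mstep_of_letter letter_of_mstep.
Proof. by case. Qed.

Lemma height_cons a p : height (a :: p) = (mstep_y a + height p)%R.
Proof. by rewrite /height big_cons. Qed.

(** The offset h is the height at the start of the suffix p. *)
Lemma Motzkin_descends (h : nat) p :
  all (fun k => (0 <= h%:Z + height (take k p))%R) (iota 0 (size p).+1)
    && (h%:Z + height p == 0)%R
  = descends h (map letter_of_mstep p).
Proof.
have height0 : height [::] = 0%R by rewrite /height big_nil.
elim: p h => [|a p IHp] h; first by rewrite /= height0; lia.
change (size (a :: p)) with (size p).+1.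
rewrite all_iotaS take0 height0 GRing.addr0 le0z_nat andTb height_cons.
have L0 : 0 \in iota 0 (size p).+1 by [].
move: (iota _ _) IHp L0 => L IHp L0.
rewrite (eq_all (a2 := fun k =>
  (0 <= h%:Z + mstep_y a + height (take k p))%R)); last first.
  by move=> k; rewrite height_cons GRing.addrA.
rewrite GRing.addrA; case: a => [c|c|] /=.
- by rewrite -IHp intS [(1 + h%:Z)%R]GRing.addrC.
- by rewrite -IHp GRing.addr0.
- case: h => [|h]; last first.
    by rewrite -IHp intS [(1 + h%:Z)%R]GRing.addrC GRing.addrK.
  apply/negbTE/negP => /andP[/allP P _].
  by have := P 0 L0; rewrite take0 height0.
Qed.

Lemma is_Motzkin_descends l p :
  is_Motzkin l p = (size p == l) && descends 0 (map letter_of_mstep p).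
Proof.
rewrite -Motzkin_descends /is_Motzkin GRing.add0r; congr andb.
by rewrite andbC; congr andb; apply: eq_all => k; rewrite GRing.add0r.
Qed.

(** A tree with n nodes gives a path of length n - 1: an arch stands for a node
but has two steps, which makes up for the shift by one in each of its two
subtrees.  The value at [Leaf] is arbitrary. *)
Fixpoint motzkin x : mpath :=
  match x with
  | Leaf => Nil
  | Node true Leaf Leaf => Nil
  | Node true l Leaf => Lev true (motzkin l)
  | Node true Leaf r => Lev false (motzkin r)
  | Node c l r => Arch c (motzkin l) (motzkin r)
  end.

Fixpoint unmotzkin (t : mpath) : btree :=
  match t with
  | Nil => Node true Leaf Leaf
  | Lev true u => Node true (unmotzkin u) Leaf
  | Lev false u => Node true Leaf (unmotzkin u)
  | Arch c u v => Node c (unmotzkin u) (unmotzkin v)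
  end.

Lemma unmotzkin_node t : is_node (unmotzkin t).
Proof. by elim: t => // -[]. Qed.

Lemma unmotzkinK : cancel unmotzkin motzkin.
Proof.
elim=> // [c t Et|[] t1 E1 t2 E2]; last by rewrite /= E1 E2.
  rewrite -[in RHS]Et; case: c => /=;
    by case: (unmotzkin t) (unmotzkin_node t).
rewrite -[in RHS]E1 -[in RHS]E2 /=.
by case: (unmotzkin t1) (unmotzkin_node t1) => // ? ? ? _;
  case: (unmotzkin t2) (unmotzkin_node t2).
Qed.

Lemma motzkinK x : wf x -> full x -> is_node x -> unmotzkin (motzkin x) = x.
Proof.
elim: x => // -[] l IHl r IHr /=.
  move=> /andP[wl wr] /andP[fl fr] _; move: (IHl wl fl) (IHr wr fr).
  case: l {IHl wl fl} => [|cl l1 l2] El;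
    case: r {IHr wr fr} => [|cr r1 r2] Er //.
  - by rewrite -[in RHS]Er.
  - by rewrite -[in RHS]El.
  - by rewrite -[in RHS]El // -[in RHS]Er.
move=> /and3P[nr wl wr] /and3P[nl fl fr] _.
by rewrite IHl // IHr.
Qed.

Lemma unmotzkin_wf_full t : wf (unmotzkin t) && full (unmotzkin t).
Proof.
elim: t => // [c t /andP[wt ft]|c t1 /andP[w1 f1] t2 /andP[w2 f2]].
  by case: c; rewrite /= wt ft.
by rewrite /= !unmotzkin_node w1 w2 f1 f2 orbT.
Qed.

Lemma size_unmotzkin t : bsize (unmotzkin t) = (size (word t)).+1.
Proof.
elim: t => // [c t IHt|c t1 IH1 t2 IH2] /=.
  by case: c; rewrite /= IHt ?addn0.
by rewrite IH1 IH2 size_cat.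
Qed.

Lemma bij_MPhu n : 0 < n ->
  in_bijection {x | sized n x && full x} (MPhu n).
Proof.
move=> n0; pose path_of t := map mstep_of_letter (@word bool bool t).
apply: (bij_sig (f := path_of \o motzkin)
  (g := fun p => unmotzkin (parse (map letter_of_mstep p)).1)) => [x|p].
  move=> /andP[Cx fx]; have nx := sized_is_node n0 Cx.
  case/andP: Cx => wx /eqP En; rewrite is_Motzkin_descends size_map /=.
  rewrite (mapK mstep_of_letterK) wordK motzkinK //.
  rewrite -[word _]cats0 descends_word cats0 andbT; split=> //.
  by rewrite -eqSS -size_unmotzkin motzkinK // En prednK.
rewrite is_Motzkin_descends => /andP[sp /word_onto[t Et]].
exists (unmotzkin t).
  have /andP[wt ft] := unmotzkin_wf_full t; rewrite /sized wt ft /= andbT.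
  by rewrite size_unmotzkin Et size_map (eqP sp) prednK.
by rewrite /= unmotzkinK /path_of Et (mapK letter_of_mstepK).
Qed.

(** * The bijections *)

Lemma two_sheets_T2 n : 0 < n ->
  two_sheets (fun x => sized n x && full x)
    (fun t => (is_Tinf t && (deg_angle t == n)) && unit_angles t)
    (fun t => node_label t == 1) deg_node
    (fun b x => relabel b (decorated x)) undecorate.
Proof.
move=> n0; apply: (two_sheets_restrict (two_sheets_Tinf n0)) => b x Cx.
by apply: unit_angles_decorated; case/andP: Cx.
Qed.

Lemma two_sheets_RP n : 0 < n ->
  two_sheets (fun x => sized n x && full x)
    (fun p => is_SP n p && D_followed_by_H p) no_D_on_diagonal (count is_H)
    (fun b x => steps (path_sheet b x)) (path_unsheet \o spath_of_steps).
Proof.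
move=> n0; apply: (two_sheets_restrict (two_sheets_SP n0)) => b x Cx.
apply: D_followed_by_H_path_sheet (sized_is_node n0 Cx).
by case/andP: Cx.
Qed.

Lemma node_label_eq0 t : (node_label t == 0) = ((node_label t == 1) == false).
Proof. by case: t => // -[]. Qed.

Lemma bij_Tinf_plus n : 0 < n -> in_bijection (Tinf_plus n) {x | sized n x}.
Proof.
move=> n0; apply: bij_trans (two_sheets_label (two_sheets_Tinf n0) true).
by apply: bij_sig_eq => t; rewrite andbA eqb_id.
Qed.

Lemma bij_Tinf_zero n : 0 < n -> in_bijection (Tinf_zero n) {x | sized n x}.
Proof.
move=> n0; apply: bij_trans (two_sheets_label (two_sheets_Tinf n0) false).
by apply: bij_sig_eq => t; rewrite andbA node_label_eq0.
Qed.

Lemma bij_SP_plus n : 0 < n -> in_bijection (SP_plus n) {x | sized n x}.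
Proof.
move=> n0; apply: bij_trans (two_sheets_label (two_sheets_SP n0) true).
by apply: bij_sig_eq => p; rewrite eqb_id.
Qed.

Lemma bij_SP_zero n : 0 < n -> in_bijection (SP_zero n) {x | sized n x}.
Proof.
move=> n0; apply: bij_trans (two_sheets_label (two_sheets_SP n0) false).
by apply: bij_sig_eq => p; rewrite eqbF_neg.
Qed.

Lemma bij_T2_plus n :
  0 < n -> in_bijection (T2_plus n) {x | sized n x && full x}.
Proof.
move=> n0; apply: bij_trans (two_sheets_label (two_sheets_T2 n0) true).
by apply: bij_sig_eq => t; rewrite eqb_id andbA [is_T2 t && _]andbAC.
Qed.

Lemma bij_T2_zero n :
  0 < n -> in_bijection (T2_zero n) {x | sized n x && full x}.
Proof.
move=> n0; apply: bij_trans (two_sheets_label (two_sheets_T2 n0) false).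
by apply: bij_sig_eq => t; rewrite node_label_eq0 andbA [is_T2 t && _]andbAC.
Qed.

Lemma bij_T2_all n :
  0 < n -> in_bijection (T2_all n) ({x | sized n x && full x} * bool)%type.
Proof.
move=> n0; apply: bij_trans (two_sheets_all (two_sheets_T2 n0)).
by apply: bij_sig_eq => t; rewrite [LHS]andbAC.
Qed.

Lemma bij_Tinf n m : 0 < n ->
  in_bijection (Tinf n m) (PT n m + PT n m.+1)%type.
Proof.
move=> n0; apply: bij_trans (bij_sym (bij_sum (bij_PT n m) (bij_PT n m.+1))).
apply: bij_trans (two_sheets_weight (two_sheets_Tinf n0) m).
by apply: bij_sig_eq => t; rewrite andbA.
Qed.

Lemma bij_SP n m : 0 < n ->
  in_bijection (PT n m + PT n m.+1)%type (SP n m).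
Proof.
move=> n0; apply: bij_trans (bij_sum (bij_PT n m) (bij_PT n m.+1)) _.
apply: bij_sym; apply: bij_trans (two_sheets_weight (two_sheets_SP n0) m).
apply: bij_sig_eq => p; case Vp: (is_SP n p) => //=.
exact: has_diag_steps_count_H.
Qed.

Lemma bij_T2_RP n m : 0 < n -> in_bijection (T2 n m) (RP n m).
Proof.
move=> n0.
have T2m := two_sheets_weight (two_sheets_T2 n0) m.
have RPm := two_sheets_weight (two_sheets_RP n0) m.
apply: (bij_trans _ (bij_trans (bij_trans T2m (bij_sym RPm)) _)).
  by apply: bij_sig_eq => t; rewrite andbA [is_T2 t && _]andbAC.
apply: bij_sym.
apply: bij_sig_eq => p; case Vp: (is_SP n p) => //=.
by rewrite (has_diag_steps_count_H _ Vp) andbC.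
Qed.

(* bool plays the role of the two-element set {0,+}. *)
Theorem corollary3p3 :
  (forall n m : nat, 1 <= n ->
     [/\ in_bijection (Tinf n m) (PT n m + PT n m.+1)%type,
         in_bijection (PT n m + PT n m.+1)%type (SP n m)
       & in_bijection (T2 n m) (RP n m)])
  /\
  (forall n : nat, 1 <= n ->
     [/\ in_bijection (Tinf_plus n) (Tinf_zero n),
         in_bijection (Tinf_zero n) (PT_all n),
         in_bijection (PT_all n) (SP_plus n)
       & in_bijection (SP_plus n) (SP_zero n)]
     /\
     [/\ in_bijection (Tinf_all n) (PT_all n * bool)%type,
         in_bijection (PT_all n * bool)%type (SP_all n)
       & exists s : nat,
           [/\ is_small_schroeder n s, has_card (SP_plus n) s
             & has_card (SP_zero n) s]])
  /\
  (forall n : nat, 1 <= n ->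
     [/\ in_bijection (T2_plus n) (T2_zero n),
         in_bijection (T2_zero n) (MPhu n)
       & in_bijection (T2_all n) (MPhu n * bool)%type]).
Proof.
split; first by move=> n m n0; split;
  [apply: bij_Tinf | apply: bij_SP | apply: bij_T2_RP].
split=> n n0.
  have cP := bij_PT_all n.
  have cSp := bij_SP_plus n0; have cS0 := bij_SP_zero n0.
  have c2 := bij_prod_bool (bij_sym cP).
  split; split.
  - exact: bij_trans (bij_Tinf_plus n0) (bij_sym (bij_Tinf_zero n0)).
  - exact: bij_trans (bij_Tinf_zero n0) (bij_sym cP).
  - exact: bij_trans cP (bij_sym cSp).
  - exact: bij_trans cSp (bij_sym cS0).
  - exact: bij_trans (two_sheets_all (two_sheets_Tinf n0)) c2.
  - exact: bij_sym (bij_trans (two_sheets_all (two_sheets_SP n0)) c2).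
  - have [s Hs] := has_card_SP_plus n; exists s.
    have cs := bij_trans (bij_sym cSp) Hs.
    by split=> //; [apply: bij_trans cP cs | apply: bij_trans cS0 cs].
have cM := bij_MPhu n0; split.
- exact: bij_trans (bij_T2_plus n0) (bij_sym (bij_T2_zero n0)).
- exact: bij_trans (bij_T2_zero n0) cM.
- exact: bij_trans (bij_T2_all n0) (bij_prod_bool cM).
Qed.
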